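(* Let $\mathcal{A}$ be a symmetric Banach algebra with unit $e$, let $\mathrm{D}$ be an unbounded closed derivation on $\mathcal{A}$ with $e\in\mathcal{D}(\mathrm{D})$, and let $k\in\mathbb{N}$, $k\ge1$. Then $\mathcal{D}(\mathrm{D}^k)$ admits norm-controlled inversion in $\mathcal{A}$. Precisely, if $a\in\mathcal{D}(\mathrm{D}^k)$ is invertible in $\mathcal{A}$, then $a^{-1}\in\mathcal{D}(\mathrm{D}^k)$ and $$|a^{-1}|_{\mathcal{D}(\mathrm{D}^k)}\le\|a^{-1}\|_{\mathcal{A}}^2\,|a|_{\mathcal{D}(\mathrm{D}^k)}\,\max\Big(k,\ \frac{\|a^{-1}\|_{\mathcal{A}}^k\,|a|_{\mathcal{D}(\mathrm{D}^k)}^k-1}{\|a^{-1}\|_{\mathcal{A}}\,|a|_{\mathcal{D}(\mathrm{D}^k)}-1}\Big),$$ where the quotient is read as $k$ if $\|a^{-1}\|_{\mathcal{A}}|a|_{\mathcal{D}(\mathrm{D}^k)}=1$. If $\|a^{-1}\|_{\mathcal{A}}\,|a|_{\mathcal{D}(\mathrm{D}^k)}>\max(2,k)$, then $$|a^{-1}|_{\mathcal{D}(\mathrm{D}^k)}\le2\,\|a^{-1}\|_{\mathcal{A}}^{k+1}\,|a|_{\mathcal{D}(\mathrm{D}^k)}^{k}.$$ Asymptotically (that is, for all sufficiently small $\delta>0$), if $|a|_{\mathcal{D}(\mathrm{D}^k)}\le1$ and $\|a^{-1}\|_{\mathcal{A}}\le\delta^{-1}$, then $|a^{-1}|_{\m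athcal{D}(\mathrm{D}^k)}\le2\,\delta^{-k-1}$.
   Context: A symmetric Banach algebra is a unital Banach $*$-algebra in which the spectrum of $a^*a$ is contained in $[0,\infty)$ for every $a$. An unbounded derivation on $\mathcal{A}$ is a closed linear mapping $\mathrm{D}:\mathcal{D}\to\mathcal{A}$ (not necessarily bounded) with domain $\mathcal{D}=\mathcal{D}(\mathrm{D})\subseteq\mathcal{A}$ satisfying $\mathrm{D}(ab)=a\,\mathrm{D}(b)+\mathrm{D}(a)\,b$ for all $a,b\in\mathcal{D}$. The domain is always taken to be the maximal one and is not assumed to be dense. Since $\mathcal{A}$ is a $*$-algebra, the derivation is assumed to be symmetric: $\mathcal{D}=\mathcal{D}^*$ and $\mathrm{D}(a^* )=\mathrm{D}(a)^*$. The domain of $\mathrm{D}^k$ is defined inductively: $a\in\mathcal{D}(\mathrm{D}^k)$ iff $a\in\mathcal{D}(\mathrm{D}^{k-1})$ and $\mathrm{D}(a)\in\mathcal{D}(\mathrm{D}^{k-1})$, with $\mathcal{D}(\mathrm{D}^0)=\mathcal{A}$ (and $\mathcal{D}(\mathrm{D}^1)=\mathcal{D}(\mathrm{D})$). It carries the seminorm and norm $$|a|_{\mathcal{D}(\mathrm{D}^k)}=\sum_{m=1}^k\frac{\|\mathrm{D}^m(a)\|_{\mathcal{A}}}{m!},\qquad\|a\|_{\mathcal{D}(\mathrm{D}^k)}=\|a\|_{\mathcal{A}}+|a|_{\mathcal{D}(\mathrm{D}^k)}.$$ For Banach algebras $\mathcal{C}\subseteq\mathcal{B}$ with common unit, $\mathcal{C}$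 admits norm-controlled inversion in $\mathcal{B}$ if there is a function $h:\mathbb{R}_+^2\to\mathbb{R}_+$ such that every $a\in\mathcal{C}$ invertible in $\mathcal{B}$ satisfies $a^{-1}\in\mathcal{C}$ and $\|a^{-1}\|_{\mathcal{C}}\le h(\|a\|_{\mathcal{C}},\|a^{-1}\|_{\mathcal{B}})$. *)

(* Defs.v *)
From HB Require Import structures.
From mathcomp Require Import all_boot all_order all_algebra.
From mathcomp Require Import complex.
From mathcomp Require Import all_classical all_reals all_analysis.

Set Implicit Arguments.
Unset Strict Implicit.
Unset Printing Implicit Defensive.

Import Order.TTheory GRing.Theory Num.Theory.
Import numFieldNormedType.Exports.

Local Open Scope classical_set_scope.
Local Open Scope ring_scope.

(* A normed algebra cannot be the join of MathComp-Analysis's normed modules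
   with MathComp's algebras: Hierarchy-Builder already has numDomainType as the
   join of normed Z-modules and rings.  So a Banach algebra is here a complex
   algebra with a real-valued norm.  [is_banach C N] says that C is a unital
   subalgebra of A on which N is a complete submultiplicative norm; the values
   of N outside C are irrelevant.  N(1) = 1 is not required. *)
Record is_banach (R : realType) (A : algType R[i]) (C : set A) (N : A -> R)
    : Prop := IsBanach {
  banach1 : C 1;
  banachP : forall (z : R[i]) (a b : A), C a -> C b -> C (z *: a + b);
  banachM : forall a b : A, C a -> C b -> C (a * b);
  banach_norm_ge0 : forall a : A, C a -> 0 <= N a;
  banach_norm0_eq0 : forall a : A, C a -> N a = 0 -> a = 0;
  (* |z| is R[i]-valued; [Re `|z|] is the same modulus, in R. *)
  banach_normZ : forall (z : R[i]) (a : A), C a ->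
    N (z *: a) = complex.Re `|z| * N a;
  banach_normD : forall a b : A, C a -> C b -> N (a + b) <= N a + N b;
  banach_normM : forall a b : A, C a -> C b -> N (a * b) <= N a * N b;
  banach_complete : forall u : nat -> A, (forall n, C (u n)) ->
    (forall eps : R, 0 < eps -> exists n0 : nat, forall m n : nat,
       (n0 <= m)%N -> (n0 <= n)%N -> N (u m - u n) < eps) ->
    exists2 l : A, C l & (fun n => N (u n - l)) @ \oo --> (0 : R)
}.

(* [GRing.unit] and [_^-1] of a unitAlgType are determined by the
   multiplication, so they do not restrict the algebra. *)
HB.mixin Record UnitAlgebra_isBanach (R : realType) A
    of GRing.UnitAlgebra R[i] A := {
  bnorm : A -> R;
  bnormP : is_banach [set: A] bnorm
}.

#[short(type="banachAlgType")]
HB.structure Definition BanachAlgebra (R : realType) :=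
  {A of GRing.UnitAlgebra R[i] A & UnitAlgebra_isBanach R A}.

(* The involution is not required to be isometric, nor even continuous. *)
HB.mixin Record BanachAlgebra_isStar (R : realType) A of BanachAlgebra R A := {
  star : A -> A;
  starK : involutive star;
  starD : {morph star : a b / a + b};
  starZ : forall (z : R[i]) (a : A), star (z *: a) = Num.conj z *: star a;
  starM : forall a b : A, star (a * b) = star b * star a
}.

#[short(type="banachStarAlgType")]
HB.structure Definition BanachStarAlgebra (R : realType) :=
  {A of BanachAlgebra R A & BanachAlgebra_isStar R A}.

Definition spectrum (R : realType) (A : banachAlgType R) (a : A) : set R[i] :=
  [set z | z%:A - a \isn't a GRing.unit].

(* In the order of R[i], [0 <= z] says that z is real and nonnegative. *)
Definition symmetric_algebra (R : realType) (A : banachStarAlgType R) : Prop :=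
  forall a : A, spectrum (star a * a) `<=` [set z | 0 <= z].

(* An operator with domain [der_dom]; the values of [der_fun] outside [der_dom]
   carry no information. *)
Record derivation (R : realType) (A : banachStarAlgType R) := Derivation {
  der_fun :> A -> A;
  der_dom : set A;
  der_dom0 : der_dom 0;
  der_domP : forall (z : R[i]) (a b : A),
    der_dom a -> der_dom b -> der_dom (z *: a + b);
  der_linear : forall (z : R[i]) (a b : A),
    der_dom a -> der_dom b -> der_fun (z *: a + b) = z *: der_fun a + der_fun b;
  (* The graph is closed in A x A. *)
  der_closed : forall (u : nat -> A) (a b : A), (forall n, der_dom (u n)) ->
    (fun n => bnorm (u n - a)) @ \oo --> (0 : R) ->
    (fun n => bnorm (der_fun (u n) - b)) @ \oo --> (0 : R) ->
    der_dom a /\ der_fun a = b;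
  der_domM : forall a b : A, der_dom a -> der_dom b -> der_dom (a * b);
  der_leibniz : forall a b : A, der_dom a -> der_dom b ->
    der_fun (a * b) = a * der_fun b + der_fun a * b;
  der_dom_star : star @` der_dom = der_dom;
  der_star : forall a : A, der_dom a -> der_fun (star a) = star (der_fun a)
}.

Section IteratedDerivation.
Variables (R : realType) (A : banachStarAlgType R) (D : derivation A).

(* The clause [der_dom D a] says that D(a) is defined; it is implied by
   [dern_dom k' a] unless k' = 0, so that dern_dom 1 = der_dom D. *)
Fixpoint dern_dom (k : nat) : set A :=
  if k is k'.+1 then
    [set a | [/\ der_dom D a, dern_dom k' a & dern_dom k' (D a)]]
  else setT.

Definition dern_seminorm (k : nat) (a : A) : R :=
  \sum_(1 <= m < k.+1) bnorm (iter m D a) / m`!%:R.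

Definition dern_norm (k : nat) (a : A) : R := bnorm a + dern_seminorm k a.

End IteratedDerivation.

Definition norm_controlled_inversion (R : realType) (B : banachAlgType R)
    (C : set B) (normC : B -> R) : Prop :=
  is_banach C normC /\
  exists h : R -> R -> R,
    (forall x y : R, 0 <= x -> 0 <= y -> 0 <= h x y) /\
    (forall a : B, C a -> a \is a GRing.unit ->
       C a^-1 /\ normC a^-1 <= h (normC a) (bnorm a^-1)).

Definition geom_quotient (R : realType) (k : nat) (x : R) : R :=
  if x == 1 then k%:R else (x ^+ k - 1) / (x - 1).

(* Main.v *)
Require Import Defs.
From HB Require Import structures.
From mathcomp Require Import all_boot all_order all_algebra.
From mathcomp Require Import complex.
From mathcomp Require Import all_classical all_reals all_analysis.
From mathcomp Require Import ring lra.
Import Order.TTheory GRing.Theory Num.Theory.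
Import numFieldNormedType.Exports.
Local Open Scope classical_set_scope.
Local Open Scope ring_scope.

(** The proof has a qualitative half, inverse-closedness of the domains, and a
quantitative half, which is pure bookkeeping with the Leibniz rule.

Inverse-closedness for k = 1.  Write |x| for the norm of A.  For b in
the domain, |D(b^n)| = O(rho^n) for every rho > |b| ([bnorm_derX_le]).  So if |b| < 1 and 1 - b is invertible in A, the
partial sums of the Neumann series converge to (1 - b)^-1 while their images
under D converge too, and closedness of D puts (1 - b)^-1 in the domain
([der_dom_neumann]).  The smallness condition involves the norm of A only, so
along a segment of elements invertible in A the property of having an inverse
in the domain propagates by steps whose length depends only on the norm of the
inverse in A ([der_dom_inv_segment]).  For a invertible in A, symmetry says
that the spectrum of a^* a is nonnegative, so that the whole segment from 1 to
a^* a consists of invertible elements ([symmetric_unit_segment]); hence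
(a^* a)^-1 lies in the domain, and so does a^-1 = (a^* a)^-1 a^*
([der_dom_inv]).  This continuation argument takes the place of the usual
comparison of spectral radii.  Higher k follows by induction from
D(a^-1) = - a^-1 D(a) a^-1 ([dern_dom_inv]).

The bound.  Put s_m(a) = |D^m(a)| / m!.  Applying D^m, m >= 1, to a a^-1 = 1 and
isolating the term a D^m(a^-1) gives
   s_m(a^-1) <= |a^-1| sum_(1 <= j <= m) s_j(a) s_(m-j)(a^-1).
With x = |a^-1|, S the seminorm of a and T_n the seminorm of order n of a^-1,
summation over m yields T_(n+1) <= x S (x + T_n), whence
   T_k <= x (y + y^2 + ... + y^k),   y = x S
([dern_seminorm_inv_le]).  This is x^2 S times the geometric quotient, and the
three estimates are elementary consequences: for y >= 2 the geometric sum is at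
most 2 y^k ([sum_geometric_le]).

The same Leibniz rule makes the norm of the k-th domain submultiplicative, and
closedness of D makes that domain complete ([dern_complete]). *)

(** * The norm of a Banach algebra *)

Section BanachNorm.
Context {R : realType} {A : banachAlgType R}.
Implicit Types a b : A.

Lemma bnorm_ge0 a : 0 <= bnorm a.
Proof. exact: (banach_norm_ge0 bnormP). Qed.

Lemma bnorm_eq0 a : bnorm a = 0 -> a = 0.
Proof. exact: (banach_norm0_eq0 bnormP). Qed.

Lemma bnormZ (t : R) a : bnorm (t%:C%C *: a) = `|t| * bnorm a.
Proof.
rewrite (banach_normZ bnormP) // normc_def /=.
by rewrite expr0n /= addr0 sqrtr_sqr.
Qed.

Lemma bnorm0 : bnorm (0 : A) = 0.
Proof. by rewrite -(scale0r (0 : A)) (bnormZ 0) normr0 mul0r. Qed.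

Lemma bnormN a : bnorm (- a) = bnorm a.
Proof.
by rewrite -scaleN1r -(rmorphN1 (real_complex R)) bnormZ normrN1 mul1r.
Qed.

Lemma bnormD a b : bnorm (a + b) <= bnorm a + bnorm b.
Proof. exact: (banach_normD bnormP). Qed.

Lemma bnormB a b : bnorm (a - b) <= bnorm a + bnorm b.
Proof. by rewrite -(bnormN b); apply: bnormD. Qed.

Lemma bnormM a b : bnorm (a * b) <= bnorm a * bnorm b.
Proof. exact: (banach_normM bnormP). Qed.

Lemma bnormMn a n : bnorm (a *+ n) = bnorm a *+ n.
Proof.
rewrite -[a *+ n]scaler_nat -(rmorph_nat (real_complex R)) bnormZ normr_nat.
by rewrite mulr_natl.
Qed.

Lemma bnorm_sum n (F : 'I_n -> A) :
  bnorm (\sum_(i < n) F i) <= \sum_(i < n) bnorm (F i).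
Proof.
apply: (big_ind2 (fun x y => bnorm x <= y)) => [|x1 x2 y1 y2 h1 h2|//].
  by rewrite bnorm0.
exact: le_trans (bnormD _ _) (lerD h1 h2).
Qed.

(** The factor |1| is there for n = 0: the norm of the unit may exceed 1. *)
Lemma bnormX_le a n : bnorm (a ^+ n) <= bnorm (1 : A) * bnorm a ^+ n.
Proof.
elim: n => [|n IH]; first by rewrite !expr0 mulr1.
rewrite !exprSr mulrA; apply: le_trans (bnormM _ _) _.
by rewrite ler_wpM2r ?bnorm_ge0.
Qed.

End BanachNorm.

Lemma cvg_bnorm_geometric {R : realType} {A : banachAlgType R}
    {u : nat -> A} {l : A} {K r : R} : 0 <= r < 1 ->
  (forall n, bnorm (u n - l) <= K * r ^+ n) ->
  (fun n => bnorm (u n - l)) @ \oo --> (0 : R).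
Proof.
move=> /andP[r0 r1] hu.
apply: (@squeeze_cvgr _ _ _ _ (fun=> 0) (fun n => K * r ^+ n)).
- by near=> n; rewrite bnorm_ge0 hu.
- exact: cvg_cst.
- rewrite -[X in _ --> X](mulr0 K).
  by apply: cvgMr; apply: cvg_expr; rewrite ger0_norm.
Unshelve. all: by end_near.
Qed.

(** * Derivations and the Neumann series *)

Section DerivationBasics.
Context {R : realType} {A : banachStarAlgType R} {D : derivation A}.
Implicit Types a b : A.

Lemma der0 : D 0 = 0.
Proof.
have := der_linear (-1) (der_dom0 D) (der_dom0 D).
by rewrite scaler0 addr0 scaleN1r addNr.
Qed.

Lemma der_domD {a b} : der_dom D a -> der_dom D b -> der_dom D (a + b).
Proof. by move=> ha hb; rewrite -[a]scale1r; apply: der_domP. Qed.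

Lemma derD {a b} : der_dom D a -> der_dom D b -> D (a + b) = D a + D b.
Proof. by move=> ha hb; rewrite -[a]scale1r der_linear // !scale1r. Qed.

Lemma der_domZ z {a} : der_dom D a -> der_dom D (z *: a).
Proof. by move=> ha; rewrite -[_ *: _]addr0; apply: der_domP (der_dom0 D). Qed.

Lemma derZ z {a} : der_dom D a -> D (z *: a) = z *: D a.
Proof.
move=> ha; rewrite -[_ *: a]addr0 der_linear ?der0 ?addr0 //; exact: der_dom0.
Qed.

Lemma der_domN {a} : der_dom D a -> der_dom D (- a).
Proof. by rewrite -scaleN1r; apply: der_domZ. Qed.

Lemma derN {a} : der_dom D a -> D (- a) = - D a.
Proof. by move=> ha; rewrite -scaleN1r derZ // scaleN1r. Qed.

Lemma der_domB {a b} : der_dom D a -> der_dom D b -> der_dom D (a - b).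
Proof. by move=> ha hb; apply: der_domD => //; apply: der_domN. Qed.

Lemma derB {a b} : der_dom D a -> der_dom D b -> D (a - b) = D a - D b.
Proof. by move=> ha hb; rewrite derD ?derN //; apply: der_domN. Qed.

Lemma der1 : der_dom D 1 -> D 1 = 0.
Proof.
move=> h1; apply: (addrI (D 1)).
by rewrite -{3}[1](mulr1 1) der_leibniz // mul1r mulr1 addr0.
Qed.

Lemma der_domX {a} n : der_dom D 1 -> der_dom D a -> der_dom D (a ^+ n).
Proof. by move=> h1 ha; elim: n => [//|n IH]; rewrite exprS; apply: der_domM. Qed.

Lemma der_dom_star_in {a} : der_dom D a -> der_dom D (star a).
Proof. by move=> ha; rewrite -der_dom_star; exists a. Qed.

(** D(a^n) is a sum of n terms of norm about |a|^(n-1) |D a|, and any r > |a|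
absorbs the factor n.  The constant C = |1| |D a| / (r - |a|) is the one for
which the recursion d_(n+1) <= |1| |a|^n |D a| + d_n |a| preserves
d_n <= C r^n, because C r^(n+1) = C r^n |a| + |1| |D a| r^n and |a| <= r. *)
Lemma bnorm_derX_le {a} {r : R} n : der_dom D 1 -> der_dom D a ->
  bnorm a < r ->
  bnorm (D (a ^+ n)) <= bnorm (1 : A) * bnorm (D a) / (r - bnorm a) * r ^+ n.
Proof.
move=> h1 ha hr; set q := bnorm a; set M := bnorm 1; set d := bnorm (D a).
have hq : 0 < r - q by rewrite subr_gt0.
have hq0 : 0 <= q by apply: bnorm_ge0.
elim: n => [|n IH].
  by rewrite expr0 der1 // bnorm0 mulr1 divr_ge0 ?mulr_ge0 ?bnorm_ge0 // ltW.
rewrite exprSr der_leibniz //; last exact: der_domX.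
apply: le_trans (bnormD _ _) _.
apply: le_trans (lerD (bnormM _ _) (bnormM _ _)) _.
have -> : M * d / (r - q) * r ^+ n.+1 =
    M * r ^+ n * d + M * d / (r - q) * r ^+ n * q.
  by rewrite exprS; field; rewrite gt_eqF.
apply: lerD; apply: ler_wpM2r; rewrite ?bnorm_ge0 //.
apply: le_trans (bnormX_le _ _) _; rewrite ler_wpM2l ?bnorm_ge0 //.
by rewrite lerXn2r ?nnegrE // ?ltW // (le_lt_trans hq0).
Qed.

(** The partial sums u_n equal (1 - b)^-1 (1 - b^n), hence converge;
applying D to (1 - b) u_n = 1 - b^n expresses D(u_n) through u_n and D(b^n), both of which converge geometrically. *)
Lemma der_dom_neumann {b} : der_dom D 1 -> der_dom D b -> bnorm b < 1 ->
  1 - b \is a GRing.unit -> der_dom D (1 - b)^-1.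
Proof.
move=> h1 hb lt1 ub; set v := (1 - b)^-1.
pose u n := \sum_(i < n) b ^+ i.
have uE n : u n = v * (1 - b ^+ n).
  by rewrite -[1 - b ^+ n]opprB subrX1 -mulNr opprB mulKr.
have domu n : der_dom D (u n).
  rewrite /u; elim/big_ind: _ => [|x y|i _]; first exact: der_dom0.
    exact: der_domD.
  exact: der_domX.
have Du n : D (u n) = v * (D b * u n - D (b ^+ n)).
  apply: (mulrI ub); rewrite mulVKr //.
  have E : (1 - b) * u n = 1 - b ^+ n by rewrite uE mulVKr.
  have := congr1 D E.
  rewrite der_leibniz //; last exact: der_domB.
  rewrite !derB ?der1 //; last exact: der_domX.
  rewrite !sub0r mulNr => /(canRL (subrK _)) ->.
  by rewrite addrC.
(* Any ratio strictly between |b| and 1 serves. *)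
have [r0 r1] : bnorm b < (1 + bnorm b) / 2 /\ (1 + bnorm b) / 2 < 1 by split; lra.
set r := (1 + bnorm b) / 2 in r0 r1.
have r01 : 0 <= r < 1 by rewrite r1 (le_trans (bnorm_ge0 b)) // ltW.
have ucv n : bnorm (u n - v) <= bnorm v * bnorm (1 : A) * r ^+ n.
  have -> : u n - v = - (v * b ^+ n) by rewrite uE mulrBr mulr1 addrC addKr.
  rewrite bnormN; apply: le_trans (bnormM _ _) _.
  rewrite -mulrA ler_wpM2l ?bnorm_ge0 //; apply: le_trans (bnormX_le _ _) _.
  rewrite ler_wpM2l ?bnorm_ge0 // lerXn2r ?nnegrE ?bnorm_ge0 // ?ltW //.
  exact: le_lt_trans (bnorm_ge0 b) r0.
have Ducv n : bnorm (D (u n) - v * (D b * v)) <=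
   bnorm v * (bnorm (D b) * (bnorm v * bnorm (1 : A)) +
              bnorm (1 : A) * bnorm (D b) / (r - bnorm b)) * r ^+ n.
  have -> : D (u n) - v * (D b * v) = v * (D b * (u n - v) - D (b ^+ n)).
    by rewrite (mulrBr (D b)) Du -(mulrBr v) addrAC.
  apply: le_trans (bnormM _ _) _; rewrite -mulrA ler_wpM2l ?bnorm_ge0 //.
  apply: le_trans (bnormB _ _) _; rewrite mulrDl lerD //;
    last exact: bnorm_derX_le.
  apply: le_trans (bnormM _ _) _; rewrite -mulrA ler_wpM2l ?bnorm_ge0 //.
have [//] := der_closed domu (cvg_bnorm_geometric r01 ucv)
                       (cvg_bnorm_geometric r01 Ducv).
Qed.

(** One step of the continuation: y = x (1 - x^-1 (x - y)), and the Neumann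
series inverts the second factor inside the domain. *)
Lemma der_dom_inv_near {x y} : der_dom D 1 -> der_dom D x^-1 -> der_dom D y ->
  x \is a GRing.unit -> y \is a GRing.unit -> bnorm (x^-1 * (x - y)) < 1 ->
  der_dom D y^-1.
Proof.
move=> h1 hx hy ux uy lt1.
have E : 1 - x^-1 * (x - y) = x^-1 * y.
  by rewrite mulrBr mulVr // opprB addrC subrK.
have u : x^-1 * y \is a GRing.unit by rewrite unitrMl ?unitrV.
have hb : der_dom D (x^-1 * (x - y)).
  by rewrite mulrBr mulVr //; apply: der_domB => //; apply: der_domM.
have := der_dom_neumann h1 hb lt1; rewrite E => /(_ u) h.
by rewrite -[y^-1](mulrK ux) -{1}[x]invrK -invrM ?unitrV //; apply: der_domM.
Qed.

End DerivationBasics.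

(** * Continuation along a segment of invertible elements *)

(** Connectedness of [0, 1] for a property that is locally constant there: the
supremum of the points where P holds belongs to them and cannot be below 1. *)
Lemma segment_continuation {R : realType} (P : R -> Prop) : P 0 ->
  (forall s, 0 <= s <= 1 -> exists2 e, 0 < e & forall t t',
     0 <= t <= 1 -> 0 <= t' <= 1 -> `|t - s| < e -> `|t' - s| < e ->
     P t -> P t') ->
  P 1.
Proof.
move=> P0 loc.
pose E : set R := [set t | 0 <= t <= 1 /\ P t].
have E0 : E 0 by split=> //; rewrite lexx ler01.
have supE : has_sup E.
  by split; [exists 0|exists 1 => x [/andP[_ ?] _]].
have ub x : E x -> x <= sup E by apply: sup_ubound; case: supE.
have s01 : 0 <= sup E <= 1.
  rewrite ub //=; apply: ge_sup; first by exists 0.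
  by move=> x [/andP[]].
have [e e0 he] := loc _ s01.
have [t [t01 Pt] ht] := sup_adherent e0 supE.
have ts : `|t - sup E| < e.
  by have := ub t (conj t01 Pt); rewrite ltr_norml; lra.
have [le1|lt1] := leP 1 (sup E + e / 2).
  apply: (he t 1) => //; first by lra.
  by rewrite ltr_norml; lra.
have : E (sup E + e / 2).
  split; first lra.
  by apply: (he t) => //; [lra|rewrite ltr_norml; lra].
by move/ub; lra.
Qed.

Section Continuation.
Context {R : realType} {A : banachStarAlgType R} {D : derivation A}.

(** Around a parameter s with K = |f(s)^-1| the inverses of f(t) are bounded by
2 K, so a single Neumann step joins any two parameters close enough to s. *)
Lemma der_dom_inv_segment {p q : A} : der_dom D 1 -> der_dom D p ->
  der_dom D q ->
  (forall t : R, 0 <= t <= 1 -> p + t%:C%C *: q \is a GRing.unit) ->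
  der_dom D p^-1 -> der_dom D (p + q)^-1.
Proof.
move=> h1 hp hq uf hpV.
pose f (t : R) : A := p + t%:C%C *: q.
have domf t : der_dom D (f t) by apply: der_domD => //; apply: der_domZ.
have fB s t : f s - f t = (s - t)%:C%C *: q.
  by rewrite rmorphB scalerBl /f opprD addrACA subrr add0r.
have -> : p + q = f 1 by rewrite /f rmorph1 scale1r.
apply: (segment_continuation (fun t => der_dom D (f t)^-1)).
  by rewrite /f rmorph0 scale0r addr0.
move=> s s01; set K := bnorm (f s)^-1; set L := bnorm q.
have K0 : 0 <= K := bnorm_ge0 _.
have L0 : 0 <= L := bnorm_ge0 _.
have KL0 : 0 <= K * L by rewrite mulr_ge0.
have KL1 : 0 < 4 * (K * L + 1) by lra.
(* The step f(t) -> f(t') needs |f(t)^-1| |t - t'| L < 1; the left side is at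
   most 2 K * 2 e * L, and the 1 added keeps e meaningful when K L = 0. *)
exists (4 * (K * L + 1))^-1; first by rewrite invr_gt0.
set e := (4 * (K * L + 1))^-1.
have eKL : e * (K * L) < 1 / 4.
  by rewrite mulrC ltr_pdivrMr //; lra.
move=> t t' t01 t'01 ts t's h.
apply: (der_dom_inv_near h1 h) => //; [exact: uf|exact: uf|].
set V := bnorm (f t)^-1.
have V0 : 0 <= V := bnorm_ge0 _.
have VK : V <= 2 * K.
  have E : (f t)^-1 = (f s)^-1 + (f t)^-1 * (f s - f t) * (f s)^-1.
    rewrite mulrBr mulVr; last exact: uf.
    rewrite mulrBl mul1r mulrK; last exact: uf.
    by rewrite addrC subrK.
  have H : V <= K + V * (`|s - t| * L) * K.
    rewrite {1}/V E; apply: le_trans (bnormD _ _) _; rewrite lerD2l.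
    apply: le_trans (bnormM _ _) _; apply: ler_wpM2r => //.
    apply: le_trans (bnormM _ _) _; apply: ler_wpM2l => //.
    by rewrite fB bnormZ.
  have : V * (`|s - t| * L) * K <= V * (1 / 4).
    rewrite -mulrA ler_wpM2l // -mulrA (mulrC L).
    apply: le_trans (ltW eKL); rewrite ler_wpM2r //.
    by rewrite distrC ltW.
  lra.
have tt' : `|t - t'| < 2 * e.
  by move: ts t's; rewrite !ltr_norml; lra.
apply: (@le_lt_trans _ _ (V * (`|t - t'| * L))).
  apply: le_trans (bnormM _ _) _; apply: ler_wpM2l => //.
  by rewrite fB bnormZ.
apply: (@le_lt_trans _ _ (2 * K * (2 * e * L))); last by lra.
apply: ler_pM => //; first by rewrite mulr_ge0.
by rewrite ler_wpM2r // ltW.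
Qed.

(** * Inverses in a symmetric algebra *)

Lemma star1 : star (1 : A) = 1.
Proof.
have := starM (star (1 : A)) 1.
by rewrite mulr1 starK mulr1.
Qed.

Lemma star_unit {a : A} : a \is a GRing.unit -> star a \is a GRing.unit.
Proof.
move=> ua; apply/unitrP; exists (star a^-1).
by rewrite -!starM mulVr // mulrV // star1.
Qed.

(** For 0 < t < 1 this element is - t (- w - a^* a) with w = (1 - t) / t, and
- w < 0 is outside the spectrum of a^* a; the endpoints are 1 and a^* a. *)
Lemma symmetric_unit_segment {a : A} {t : R} : symmetric_algebra A ->
  a \is a GRing.unit -> 0 <= t <= 1 ->
  1 + t%:C%C *: (star a * a - 1) \is a GRing.unit.
Proof.
move=> symA ua /andP[t0 t1].
have [->|tn0] := eqVneq t 0; first by rewrite rmorph0 scale0r addr0 unitr1.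
have [->|tn1] := eqVneq t 1.
  by rewrite rmorph1 scale1r addrC subrK unitrMl // star_unit.
have lt0 : 0 < t by rewrite lt_neqAle eq_sym tn0.
have lt1 : t < 1 by rewrite lt_neqAle tn1.
set w := (1 - t) / t.
have w0 : 0 < w by rewrite divr_gt0 // subr_gt0.
have -> : 1 + t%:C%C *: (star a * a - 1) =
    (- t)%:C%C *: ((- w)%:C%C%:A - star a * a).
  rewrite (scalerBr (- t)%:C%C) scalerA -rmorphM mulrN mulNr opprK.
  rewrite /w mulrC divfK //.
  rewrite [(- t)%:C%C]rmorphN scaleNr opprK rmorphB rmorph1 scalerBl scale1r.
  by rewrite scalerBr addrA addrAC.
have ut : (- t)%:C%C \is a GRing.unit.
  by rewrite unitfE fmorph_eq0 oppr_eq0.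
rewrite scaler_unit //.
apply: contraT => /(symA a) /=.
by rewrite lecR oppr_ge0 leNgt w0.
Qed.

(** The inverse of a^* a is reached from 1 by continuation, and it gives the
inverse of a through a^-1 = (a^* a)^-1 a^*. *)
Lemma der_dom_inv {a : A} : symmetric_algebra A -> der_dom D 1 ->
  der_dom D a -> a \is a GRing.unit -> der_dom D a^-1.
Proof.
move=> symA h1 ha ua.
have hs := der_dom_star_in ha.
have hc : der_dom D (star a * a) by apply: der_domM.
have := der_dom_inv_segment h1 h1 (der_domB hc h1)
  (fun t => symmetric_unit_segment symA ua).
rewrite invr1 addrC subrK => /(_ h1) hV.
have -> : a^-1 = (star a * a)^-1 * star a.
  by rewrite invrM ?star_unit // mulrVK ?star_unit.
exact: der_domM.
Qed.

Lemma der_fun_inv {a : A} : der_dom D 1 -> der_dom D a -> der_dom D a^-1 ->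
  a \is a GRing.unit -> D a^-1 = - (a^-1 * D a * a^-1).
Proof.
move=> h1 ha hV ua; apply: (mulrI ua).
rewrite mulrN -!mulrA mulVKr //; apply/eqP; rewrite -addr_eq0.
by rewrite -der_leibniz // mulrV // der1.
Qed.

End Continuation.

(** * Domains of the powers of a derivation *)

Section IteratedDomain.
Context {R : realType} {A : banachStarAlgType R} {D : derivation A}.
Implicit Types a b : A.

(** The branching recursion that defines the domain amounts to a condition on
the single orbit a, D(a), D^2(a), ...; linearity and completeness are checked
along it. *)
Lemma dern_dom_iterP k a :
  dern_dom D k a <-> forall j, (j < k)%N -> der_dom D (iter j D a).
Proof.
elim: k a => [|k IH] a; first by split.
split=> [[h0 h1 h2] [//|j] jk|h].
  by rewrite iterSr; apply: (IH (D a)).1.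
split; first exact: (h 0%N).
  by apply/IH => j jk; apply/h/ltnW.
by apply/IH => j jk; rewrite -iterSr; apply: h.
Qed.

Lemma dern_dom_le {k} j {a} : (j <= k)%N -> dern_dom D k a -> dern_dom D j a.
Proof.
move=> jk /dern_dom_iterP h; apply/dern_dom_iterP => i ij.
exact/h/(leq_trans ij).
Qed.

Lemma iter_der_linear {m} z {a b} : dern_dom D m a -> dern_dom D m b ->
  iter m D (z *: a + b) = z *: iter m D a + iter m D b.
Proof.
elim: m a b => [//|m IH] a b [a0 a1 a2] [b0 b1 b2].
by rewrite !iterSr der_linear // IH.
Qed.

Lemma dern_domP {k} z {a b} : dern_dom D k a -> dern_dom D k b ->
  dern_dom D k (z *: a + b).
Proof.
move=> ha hb; apply/dern_dom_iterP => j jk.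
have [ha' hb'] := (dern_dom_le j (ltnW jk) ha, dern_dom_le j (ltnW jk) hb).
rewrite iter_der_linear //.
by apply: der_domP; [apply: (dern_dom_iterP k a).1|apply: (dern_dom_iterP k b).1].
Qed.

Lemma iter_der0 m : iter m D 0 = 0.
Proof. by elim: m => [//|m /= ->]; apply: der0. Qed.

Lemma dern_dom0 k : dern_dom D k 0.
Proof.
by apply/dern_dom_iterP => j _; rewrite iter_der0; apply: der_dom0.
Qed.

Lemma dern_domD {k a b} : dern_dom D k a -> dern_dom D k b ->
  dern_dom D k (a + b).
Proof. by move=> ha hb; rewrite -[a]scale1r; apply: dern_domP. Qed.

Lemma iter_derD {m a b} : dern_dom D m a -> dern_dom D m b ->
  iter m D (a + b) = iter m D a + iter m D b.
Proof. by move=> ha hb; rewrite -[a]scale1r iter_der_linear // !scale1r. Qed.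

Lemma dern_domN {k a} : dern_dom D k a -> dern_dom D k (- a).
Proof.
move=> ha; rewrite -scaleN1r -[_ *: _]addr0; apply: dern_domP => //.
exact: dern_dom0.
Qed.

Lemma iter_derZ {m} z {a} : dern_dom D m a -> iter m D (z *: a) = z *: iter m D a.
Proof.
move=> ha; rewrite -[z *: a]addr0 iter_der_linear //; last exact: dern_dom0.
by rewrite iter_der0 addr0.
Qed.

Lemma iter_derB {m a b} : dern_dom D m a -> dern_dom D m b ->
  iter m D (a - b) = iter m D a - iter m D b.
Proof.
move=> ha hb; rewrite iter_derD //; last exact: dern_domN.
by rewrite -(scaleN1r b) iter_derZ // scaleN1r.
Qed.

Lemma dern_dom1 k : der_dom D 1 -> dern_dom D k 1.
Proof.
move=> h1; apply/dern_dom_iterP => -[//|j] _.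
by rewrite iterSr der1 // iter_der0; apply: der_dom0.
Qed.

Lemma dern_domM {k a b} : dern_dom D k a -> dern_dom D k b ->
  dern_dom D k (a * b).
Proof.
elim: k a b => [//|k IH] a b [a0 a1 a2] [b0 b1 b2].
split; [exact: der_domM|exact: IH|].
by rewrite der_leibniz //; apply: dern_domD; apply: IH.
Qed.

Lemma dern_dom_inv {k a} : symmetric_algebra A -> der_dom D 1 ->
  dern_dom D k a -> a \is a GRing.unit -> dern_dom D k a^-1.
Proof.
move=> symA h1 + ua; elim: k => [//|k IH] [a0 a1 a2].
have hV := der_dom_inv symA h1 a0 ua.
split => //; first exact: IH.
rewrite der_fun_inv //; apply/dern_domN/dern_domM; last exact: IH.
by apply: dern_domM => //; apply: IH.
Qed.

(** The induction is Pascal's rule; D is applied to the product first and its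
m-th power afterwards, in accordance with the recursion of the domain. *)
Lemma iter_der_leibniz {m a b} : dern_dom D m a -> dern_dom D m b ->
  iter m D (a * b) =
    \sum_(j < m.+1) (iter j D a * iter (m - j) D b) *+ 'C(m, j).
Proof.
elim: m a b => [|m IH] a b ha hb; first by rewrite big_ord1 bin0.
have [[a0 a1 a2] [b0 b1 b2]] := (ha, hb).
rewrite iterSr der_leibniz // iter_derD; [|exact: dern_domM|exact: dern_domM].
rewrite !IH // [RHS]big_ord_recl [X in X + _ = _]big_ord_recl /= -addrA.
rewrite -iterSr !subn0 !bin0; congr (_ + _).
under [RHS]eq_bigr => i _ do rewrite /bump /= add1n binS subSS mulrnDr.
rewrite big_split /=; congr (_ + _); last first.
  by apply: eq_bigr => i _; rewrite -iterSr.
(* The extra last term of this half carries the coefficient C(m, m + 1) = 0. *)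
rewrite big_ord_recr /= (@bin_small m m.+1) // mulr0n addr0.
apply: eq_bigr => i _.
by rewrite /bump /= add1n -iterSr -subSn.
Qed.

End IteratedDomain.

(** * Two estimates for finite sums *)

Section CauchyProduct.
Context {R : realType}.

(** The left side runs over the pairs with j + i < n, a part of the square of
pairs on the right.  In the induction the row j = 0 is split off and p is
shifted. *)
Lemma cauchy_product_le n (p q : nat -> R) :
  (forall i, 0 <= p i) -> (forall i, 0 <= q i) ->
  \sum_(m < n) \sum_(j < m.+1) p j * q (m - j)%N <=
    (\sum_(j < n) p j) * (\sum_(i < n) q i).
Proof.
move=> + q0; elim: n p => [|n IH] p p0; first by rewrite !big_ord0 mul0r.
under eq_bigr => m _.
  rewrite big_ord_recl subn0; under eq_bigr => j _ do rewrite lift0; over.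
rewrite big_split /= -mulr_sumr [X in _ <= X * _]big_ord_recl mulrDl lerD2l.
rewrite big_ord_recl big_ord0 add0r.
apply: le_trans (IH (fun j => p j.+1) (fun j => p0 j.+1)) _.
apply: ler_wpM2l; first exact: sumr_ge0.
by rewrite big_ord_recr /= lerDl.
Qed.

Lemma sum_geometric_le (y : R) k : 2 <= y ->
  \sum_(i < k) y ^+ i.+1 <= 2 * y ^+ k.
Proof.
move=> y2; elim: k => [|k IH]; first by rewrite big_ord0 expr0 mulr1.
rewrite big_ord_recr /=.
have : 2 * y ^+ k <= y ^+ k.+1.
  by rewrite exprS ler_wpM2r // exprn_ge0 // (le_trans _ y2).
lra.
Qed.

Lemma ler_sum_geometric (x y : R) k : 0 <= x <= y ->
  \sum_(i < k) x ^+ i.+1 <= \sum_(i < k) y ^+ i.+1.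
Proof.
move=> /andP[x0 xy]; apply: ler_sum => i _.
by rewrite lerXn2r // nnegrE // (le_trans x0).
Qed.

End CauchyProduct.

(** * The inverse in terms of Taylor coefficients *)

(** The norm of the m-th Taylor coefficient of t |-> exp(t D) a; with the factor
1/m! the Leibniz rule becomes a Cauchy product. *)
Definition der_coef {R : realType} {A : banachStarAlgType R}
  (D : derivation A) (m : nat) (a : A) : R := bnorm (iter m D a) / m`!%:R.

Section Coefficients.
Context {R : realType} {A : banachStarAlgType R} {D : derivation A}.
Implicit Types a b : A.
Local Notation s := (der_coef D).

Lemma fact_gt0R n : 0 < n`!%:R :> R.
Proof. by rewrite ltr0n fact_gt0. Qed.

Lemma der_coef_ge0 m a : 0 <= s m a.
Proof. by rewrite divr_ge0 ?bnorm_ge0 // ltW // fact_gt0R. Qed.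

Lemma der_coef0 a : s 0 a = bnorm a.
Proof. by rewrite /der_coef fact0 divr1. Qed.

Lemma dern_seminormE k a : dern_seminorm D k a = \sum_(m < k) s m.+1 a.
Proof. by rewrite /dern_seminorm big_add1 big_mkord. Qed.

Lemma dern_normE k a : dern_norm D k a = \sum_(m < k.+1) s m a.
Proof. by rewrite /dern_norm dern_seminormE big_ord_recl der_coef0. Qed.

Lemma dern_seminorm_ge0 k a : 0 <= dern_seminorm D k a.
Proof. by rewrite dern_seminormE sumr_ge0 // => i _; apply: der_coef_ge0. Qed.

(** This is C(m, j) j! (m - j)! = m!. *)
Lemma leibniz_term_le m j a b : (j <= m)%N ->
  bnorm ((iter j D a * iter (m - j) D b) *+ 'C(m, j)) <=
    m`!%:R * (s j a * s (m - j)%N b).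
Proof.
move=> jm; rewrite bnormMn -[leLHS]mulr_natl -(bin_fact jm) natrM -mulrA.
apply: ler_wpM2l => //; apply: le_trans (bnormM _ _) _.
rewrite /der_coef natrM; set x := bnorm _; set y := bnorm _.
rewrite [leRHS](_ : _ = x * y) //.
by field; rewrite !gt_eqF ?fact_gt0R.
Qed.

Lemma der_coefM_le m a b : dern_dom D m a -> dern_dom D m b ->
  s m (a * b) <= \sum_(j < m.+1) s j a * s (m - j)%N b.
Proof.
move=> ha hb; rewrite /(s m _) ler_pdivrMr ?fact_gt0R // mulrC mulr_sumr.
rewrite iter_der_leibniz //; apply: le_trans (bnorm_sum _ _) _.
by apply: ler_sum => j _; apply: leibniz_term_le; rewrite -ltnS.
Qed.

(** D^(m+1) kills a a^-1 = 1, and the j = 0 term of its Leibniz sum is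
a D^(m+1)(a^-1). *)
Lemma der_coef_inv_le m a : der_dom D 1 -> dern_dom D m.+1 a ->
  dern_dom D m.+1 a^-1 -> a \is a GRing.unit ->
  s m.+1 a^-1 <= bnorm a^-1 * \sum_(j < m.+1) s j.+1 a * s (m - j)%N a^-1.
Proof.
move=> h1 ha hV ua.
have := iter_der_leibniz ha hV; rewrite mulrV // iterSr der1 // iter_der0.
rewrite big_ord_recl /= bin0 -iterS => /esym/eqP; rewrite addr_eq0 => /eqP.
move=> /(canRL (mulKr ua)) E.
rewrite /(s m.+1 _) ler_pdivrMr ?fact_gt0R // E mulrN bnormN.
apply: le_trans (bnormM _ _) _; rewrite -mulrA ler_wpM2l ?bnorm_ge0 //.
rewrite mulrC mulr_sumr; apply: le_trans (bnorm_sum _ _) _.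
apply: ler_sum => j _; exact: (leibniz_term_le m.+1 j.+1 a a^-1 (ltn_ord j)).
Qed.

(** Summing [der_coef_inv_le] gives T_(n+1) <= x S (x + T_n) for the seminorms
T_n of a^-1: in the Cauchy product the factor of a^-1 runs over the orders
0, ..., n, whose order 0 term is x.  The bound is the solution of that
recursion. *)
Lemma dern_seminorm_inv_le {k a} : der_dom D 1 -> dern_dom D k a ->
  dern_dom D k a^-1 -> a \is a GRing.unit ->
  dern_seminorm D k a^-1 <= bnorm a^-1 *
    \sum_(i < k) (bnorm a^-1 * dern_seminorm D k a) ^+ i.+1.
Proof.
move=> h1 ha hV ua.
set x := bnorm a^-1; set S := dern_seminorm D k a.
have x0 : 0 <= x := bnorm_ge0 _.
have S0 : 0 <= S := dern_seminorm_ge0 _ _.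
suff H n : (n <= k)%N ->
    dern_seminorm D n a^-1 <= x * \sum_(i < n) (x * S) ^+ i.+1 by exact: H.
elim: n => [|n IH] nk; first by rewrite dern_seminormE !big_ord0 mulr0.
apply: (@le_trans _ _ (x * S * (x + dern_seminorm D n a^-1))); last first.
  rewrite big_ord_recl expr1 mulrDr mulrDr lerD //; first by rewrite mulrC.
  apply: le_trans (ler_wpM2l _ (IH (ltnW nk))) _; first exact: mulr_ge0.
  rewrite mulrCA ler_wpM2l // mulr_sumr; apply: ler_sum => i _.
  by rewrite lift0 [leRHS]exprS.
rewrite dern_seminormE.
have step (m : 'I_n.+1) : s m.+1 a^-1 <=
    x * \sum_(j < m.+1) s j.+1 a * s (m - j)%N a^-1.
  by apply: der_coef_inv_le => //; apply: dern_dom_le (leq_trans _ nk) _.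
apply: le_trans (ler_sum _ (fun m _ => step m)) _.
rewrite -mulr_sumr -mulrA ler_wpM2l //.
apply: le_trans (cauchy_product_le _ (fun j => s j.+1 a) (fun j => s j a^-1) _ _) _.
- by move=> i; apply: der_coef_ge0.
- by move=> i; apply: der_coef_ge0.
rewrite [X in _ * X]big_ord_recl der_coef0 -/x dern_seminormE.
apply: ler_wpM2r.
  by rewrite addr_ge0 // sumr_ge0 // => i _; apply: der_coef_ge0.
rewrite /S dern_seminormE -(subnKC nk) big_split_ord /= lerDl.
by rewrite sumr_ge0 // => i _; apply: der_coef_ge0.
Qed.

Lemma dern_normM_le {k a b} : dern_dom D k a -> dern_dom D k b ->
  dern_norm D k (a * b) <= dern_norm D k a * dern_norm D k b.
Proof.
move=> ha hb; rewrite !dern_normE.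
apply: le_trans (cauchy_product_le _ (fun j => s j a) (fun j => s j b) _ _);
  try by move=> i; apply: der_coef_ge0.
apply: ler_sum => m _; apply: der_coefM_le.
  by apply: dern_dom_le ha; rewrite -ltnS.
by apply: dern_dom_le hb; rewrite -ltnS.
Qed.

Lemma bnorm_iter_le {m k a} : (m <= k)%N ->
  bnorm (iter m D a) <= m`!%:R * dern_norm D k a.
Proof.
move=> mk; rewrite -ler_pdivrMl ?fact_gt0R // mulrC dern_normE.
rewrite -/(der_coef D m a) (bigD1 (Ordinal (mk : (m < k.+1)%N))) //= lerDl.
by rewrite sumr_ge0 // => i _; apply: der_coef_ge0.
Qed.

(** Each sequence D^m(u_n) is Cauchy in A; closedness of D identifies the limit
of order m + 1 with the image of the limit of order m. *)
Lemma dern_complete {k} (u : nat -> A) : (forall n, dern_dom D k (u n)) ->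
  (forall eps : R, 0 < eps -> exists n0 : nat, forall m n : nat,
     (n0 <= m)%N -> (n0 <= n)%N -> dern_norm D k (u m - u n) < eps) ->
  exists2 l : A, dern_dom D k l &
    (fun n => dern_norm D k (u n - l)) @ \oo --> (0 : R).
Proof.
move=> hu cau.
have domu m n : (m <= k)%N -> dern_dom D m (u n).
  by move=> mk; apply: dern_dom_le (hu n).
have ex m : exists l : A, (m <= k)%N ->
    (fun n => bnorm (iter m D (u n) - l)) @ \oo --> (0 : R).
  have [mk|] := leqP m k; last by exists 0.
  have [] := @banach_complete _ _ _ _ bnormP (fun n => iter m D (u n)) (fun=> I).
    move=> eps e0; have [|n0 hn0] := cau (eps / m`!%:R).
      by rewrite divr_gt0 // fact_gt0R.
    exists n0 => p n hp hn; rewrite -iter_derB; try exact: domu.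
    apply: le_lt_trans (bnorm_iter_le mk) _.
    by rewrite mulrC -ltr_pdivlMr ?fact_gt0R //; apply: hn0.
  by move=> l _ hl; exists l.
have [l hl] := choice ex.
have graph m : (m < k)%N -> der_dom D (l m) /\ D (l m) = l m.+1.
  move=> mk; apply: (der_closed _ (hl m (ltnW mk)) (hl m.+1 mk)) => n.
  by apply: (dern_dom_iterP k (u n)).1.
have iterl m : (m <= k)%N -> iter m D (l 0%N) = l m.
  by elim: m => [//|m IH] mk; rewrite iterS IH ?(ltnW mk) //; apply: (graph m mk).2.
have doml : dern_dom D k (l 0%N).
  by apply/dern_dom_iterP => j jk; rewrite iterl ?(ltnW jk) //; apply: (graph j jk).1.
exists (l 0%N) => //.
have E n : dern_norm D k (u n - l 0%N) =
    \sum_(m < k.+1) bnorm (iter m D (u n) - l m) / m`!%:R.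
  rewrite dern_normE; apply: eq_bigr => m _.
  have mk : (m <= k)%N by rewrite -ltnS.
  rewrite /der_coef iter_derB ?iterl //; first exact: domu.
  exact: dern_dom_le doml.
suff : (fun n => dern_norm D k (u n - l 0%N)) @ \oo -->
    \sum_(m < k.+1) (0 / m`!%:R : R).
  by rewrite big1 // => m _; rewrite mul0r.
under eq_fun do rewrite E.
apply: cvg_big => [|m _]; first exact: add_continuous.
by apply: cvgMl; apply: hl; rewrite -ltnS.
Qed.

Lemma dern_is_banach k : der_dom D 1 ->
  is_banach (dern_dom D k) (dern_norm D k).
Proof.
move=> h1; split.
- exact: dern_dom1.
- by move=> z a b; apply: dern_domP.
- by move=> a b; apply: dern_domM.
- by move=> a _; rewrite addr_ge0 ?bnorm_ge0 ?dern_seminorm_ge0.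
- move=> a _ na0; apply: bnorm_eq0; apply/eqP; rewrite eq_le bnorm_ge0 andbT.
  by rewrite -na0 lerDl dern_seminorm_ge0.
- move=> z a ha; rewrite !dern_normE mulr_sumr; apply: eq_bigr => m _.
  rewrite /der_coef iter_derZ; last by apply: dern_dom_le ha; rewrite -ltnS.
  by rewrite (banach_normZ bnormP) // mulrA.
- move=> a b ha hb; rewrite !dern_normE -big_split /=; apply: ler_sum => m _.
  have mk : (m <= k)%N by rewrite -ltnS.
  rewrite /der_coef iter_derD; [|exact: dern_dom_le ha|exact: dern_dom_le hb].
  by rewrite -mulrDl ler_wpM2r ?bnormD // invr_ge0 ltW // fact_gt0R.
- by move=> a b; apply: dern_normM_le.
- exact: dern_complete.
Qed.

End Coefficients.

(** * The theorem *)

Lemma geom_quotientE (R : realType) k (y : R) :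
  geom_quotient k y = \sum_(i < k) y ^+ i.
Proof.
rewrite /geom_quotient; case: eqVneq => [->|y1].
  by under eq_bigr do rewrite expr1n; rewrite sumr_const card_ord.
by rewrite subrX1 mulrC mulKf // subr_eq0.
Qed.

Theorem proposition2p5 (R : realType) (A : banachStarAlgType R)
    (A_symmetric : symmetric_algebra A) (D : derivation A)
    (D_unit : der_dom D (1 : A)) (k : nat) (k_ge1 : (1 <= k)%N) :
  norm_controlled_inversion (dern_dom D k) (dern_norm D k) /\
  (forall a : A, dern_dom D k a -> a \is a GRing.unit ->
     [/\ dern_dom D k a^-1,
         dern_seminorm D k a^-1 <=
           bnorm a^-1 ^+ 2 * dern_seminorm D k a *
           Num.max k%:R (geom_quotient k (bnorm a^-1 * dern_seminorm D k a))
       & Num.max 2 k%:R < bnorm a^-1 * dern_seminorm D k a ->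
         dern_seminorm D k a^-1 <=
           2 * bnorm a^-1 ^+ k.+1 * dern_seminorm D k a ^+ k]) /\
  (\forall d \near (0 : R)^'+, forall a : A,
     dern_dom D k a -> a \is a GRing.unit ->
     dern_seminorm D k a <= 1 -> bnorm a^-1 <= d^-1 ->
     dern_seminorm D k a^-1 <= 2 * d ^- k.+1).
Proof.
have inv (a : A) (ha : dern_dom D k a) := dern_dom_inv A_symmetric D_unit ha.
have bound (a : A) (ha : dern_dom D k a) (ua : a \is a GRing.unit) :=
  dern_seminorm_inv_le D_unit ha (inv a ha ua) ua.
have x0 (a : A) := bnorm_ge0 a.
have S0 (a : A) : 0 <= dern_seminorm D k a := dern_seminorm_ge0 _ _.
split; [|split].
- split; first exact: dern_is_banach.
  exists (fun u v => v + v * \sum_(i < k) (v * u) ^+ i.+1); split.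
    move=> u v u0 v0; rewrite addr_ge0 // mulr_ge0 // sumr_ge0 // => i _.
    by rewrite exprn_ge0 // mulr_ge0.
  move=> a ha ua; split; first exact: inv.
  rewrite /dern_norm lerD2l; apply: le_trans (bound a ha ua) _.
  rewrite ler_wpM2l //; apply: ler_sum_geometric.
  by rewrite mulr_ge0 //= ler_wpM2l // lerDr.
- move=> a ha ua; have b := bound a ha ua.
  set x := bnorm a^-1 in b *; set S := dern_seminorm D k a in b *.
  have [hx hS] : 0 <= x /\ 0 <= S by split; [exact: x0|exact: S0].
  split; first exact: inv.
    apply: (le_trans b); rewrite geom_quotientE.
    under eq_bigr do rewrite exprS; rewrite -mulr_sumr !mulrA -expr2.
    apply: ler_wpM2l; first by rewrite mulr_ge0 ?exprn_ge0.
    by rewrite le_max lexx orbT.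
  rewrite gt_max => /andP[y2 _]; apply: (le_trans b).
  apply: (@le_trans _ _ (x * (2 * (x * S) ^+ k))).
    by apply: ler_wpM2l; [exact: x0|apply: sum_geometric_le; exact: ltW].
  by rewrite exprMn exprS -!mulrA mulrCA.
- near=> d => a ha ua S1 xd.
  have d0 : 0 < d by near: d; exact: nbhs_right_gt.
  have d2 : 2 <= d^-1.
    (* The sum bound applies as soon as d <= 1 / 2. *)
    rewrite -[2]invrK lef_pV2 ?posrE ?invr_gt0 //.
    by near: d; apply: nbhs_right_le; rewrite invr_gt0.
  apply: le_trans (bound a ha ua) _.
  rewrite -exprVn exprS mulrCA; apply: ler_pM => //.
    by rewrite sumr_ge0 // => i _; rewrite exprn_ge0 // mulr_ge0.
  apply: le_trans (sum_geometric_le d^-1 k d2); apply: ler_sum_geometric.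
  rewrite mulr_ge0 //=; apply: le_trans xd.
  by rewrite -[leRHS]mulr1 ler_wpM2l.
Unshelve. all: by end_near.
Qed.
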